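(* Let $\mathrm{X}_1\subset\mathbb{R}^{n_1}$ and $\mathrm{X}_2\subset\mathbb{R}^{n_2}$ be nonempty, convex, and compact. Let $J_1:\mathrm{X}_1\times\mathrm{X}_2\to\mathbb{R}$ be continuous on $\mathrm{X}_1\times\mathrm{X}_2$, and let $\mathrm{BR}_2$ be the best-response correspondence of Player 2. Suppose that: (i) there is $\mu>0$ such that for every fixed $x_2\in\mathrm{X}_2$ the function $J_1(\cdot,x_2)$ is differentiable and $\mu$-strongly convex on $\mathrm{X}_1$; (ii) there is $L_{12}\ge 0$ such that for every $x_1\in\mathrm{X}_1$ and all $x_2,y_2\in\mathrm{X}_2$, $\|\nabla_{x_1}J_1(x_1,x_2)-\nabla_{x_1}J_1(x_1,y_2)\|\le L_{12}\|x_2-y_2\|$; (iii) for every $x_1\in\mathrm{X}_1$, $\mathrm{BR}_2(x_1)$ is single-valued (a singleton), so that $\mathrm{BR}_2$ is regarded as a map $\mathrm{X}_1\to\mathrm{X}_2$; (iv) the map $\mathrm{BR}_2:\mathrm{X}_1\to\mathrm{X}_2$ is Lipschitz on $\mathrm{X}_1$ with constant $L_2\ge 0$; (v) there is a constant $L_1$ such that for every fixed $x_2\in\mathrm{X}_2$ the function $J_1(\cdot,x_2)$ is $L_1$-smooth on $\mathrm{X}_1$, i.e., for all $x_1,y_1\in\mathrm{X}_1$, $\|\nabla_{x_1}J_1(x_1,x_2)-\nabla_{x_1}J_1(y_1,x_2)\|\le L_1\|x_1-y_1\|$; (vi) $\mu>L_{12}L_2$. Let $m:=\mu-L_{12}L_2$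 and $L_G:=L_1+L_{12}L_2$, so that $m>0$ by (vi). Then, for any stepsize $\alpha$ satisfying $$0<\alpha<\frac{2m}{L_G^2}=\frac{2(\mu-L_{12}L_2)}{(L_1+L_{12}L_2)^2},$$ the iterates generated, from any initial point $x_1^0\in\mathrm{X}_1$, by $$x_2^k=\mathrm{BR}_2(x_1^k),\qquad x_1^{k+1}=\Pi_{\mathrm{X}_1}\!\left(x_1^k-\alpha\nabla_{x_1}J_1(x_1^k,x_2^k)\right),\qquad k\ge 0,$$ satisfy $$\|x_1^k-x_1^\star\|\le\rho(\alpha)^k\|x_1^0-x_1^\star\|,\qquad \|x_2^k-x_2^\star\|\le L_2\,\rho(\alpha)^k\|x_1^0-x_1^\star\|,$$ where $(x_1^\star,x_2^\star)$ is the unique Nash equilibrium of the asymmetric-information two-player game defined by $(\mathrm{X}_1,\mathrm{X}_2,J_1,\mathrm{BR}_2)$ and $$\rho(\alpha):=\sqrt{1-2\alpha m+\alpha^2L_G^2}\in(0,1).$$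
   Context: The asymmetric-information two-player game: Player 1 chooses $x_1\in\mathrm{X}_1$ to minimize $J_1(x_1,x_2)$ over $x_1\in\mathrm{X}_1$, while Player 2 simultaneously reacts with $x_2\in\mathrm{BR}_2(x_1)$. Here $\mathrm{BR}_2(x_1)=\arg\min_{x_2\in\mathrm{X}_2}J_2(x_1,x_2)$ for some objective $J_2$ which need not be known to Player 1; Player 2 enters only through $\mathrm{BR}_2$. A pair $(x_1^\star,x_2^\star)\in\mathrm{X}_1\times\mathrm{X}_2$ is a Nash equilibrium of this game if $x_1^\star\in\arg\min_{x_1\in\mathrm{X}_1}J_1(x_1,x_2^\star)$ and $x_2^\star\in\mathrm{BR}_2(x_1^\star)$. Under the compactness and convexity of the feasible sets, the continuity of $J_1$, and hypotheses (i)–(iv) and (vi), the game has exactly one Nash equilibrium. $\|\cdot\|$ is the Euclidean norm, $\nabla_{x_1}J_1(x_1,x_2)$ denotes the gradient of $J_1(\cdot,x_2)$ at $x_1$, and $\Pi_{\mathrm{X}_1}$ denotes Euclidean projection onto $\mathrm{X}_1$.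
   Formalization: ρ(α)∈(0,1) can fail; proved instead: 0≤ρ(α)<1, with ρ(α)>0 unless L_1=μ, L_12L_2=0 and αμ=1, or L_1<μ and X_1 is a single point (a negative radicand gives ρ=0). If L_G=0 (X_1 a single point) no stepsize is admissible. *)

(* Defs.v *)
From mathcomp Require Export all_boot all_order all_algebra.
From mathcomp Require Export all_classical all_reals all_analysis.
Export Order.TTheory GRing.Theory Num.Theory.
Export numFieldNormedType.Exports.

Set Implicit Arguments.
Unset Strict Implicit.
Unset Printing Implicit Defensive.

Local Open Scope classical_set_scope.
Local Open Scope ring_scope.

Definition dotv {R : realType} {n : nat} (u v : 'rV[R]_n) : R :=
  \sum_i u ord0 i * v ord0 i.

(* The library's `|x| on row vectors is the sup norm; the two norms induce the
   same topology. *)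
Definition norm2 {R : realType} {n : nat} (u : 'rV[R]_n) : R :=
  Num.sqrt (dotv u u).

Definition argmin {R : realType} {T : Type} (A : set T) (f : T -> R) : set T :=
  [set x | A x /\ forall y, A y -> f x <= f y].

Definition proj {R : realType} {n : nat} (X : set 'rV[R]_n) (z : 'rV[R]_n) :
    'rV[R]_n :=
  get (argmin X (fun y => norm2 (z - y))).

(* f(y) = f(x) + <g, y - x> + o(|y - x|) as y tends to x inside X.  Only the
   values of f on X matter.  When X has nonempty interior and is convex, g is
   uniquely determined; when f is differentiable on a neighbourhood of x, the
   usual gradient satisfies this. *)
Definition is_gradient_within {R : realType} {n : nat} (X : set 'rV[R]_n)
    (f : 'rV[R]_n -> R) (x g : 'rV[R]_n) : Prop :=
  (f y - f x - dotv g (y - x)) / norm2 (y - x) @[y --> within X x^'] --> (0 : R).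

Definition strongly_convex {R : realType} {n : nat} (mu : R)
    (X : set 'rV[R]_n) (f : 'rV[R]_n -> R) : Prop :=
  forall (x y : 'rV[R]_n) (t : R), X x -> X y -> 0 <= t <= 1 ->
    f (t *: x + (1 - t) *: y) <=
      t * f x + (1 - t) * f y - mu / 2 * t * (1 - t) * norm2 (x - y) ^+ 2.

Definition lipschitz_on {R : realType} {n p : nat} (L : R)
    (X : set 'rV[R]_n) (F : 'rV[R]_n -> 'rV[R]_p) : Prop :=
  forall x y : 'rV[R]_n, X x -> X y ->
    norm2 (F x - F y) <= L * norm2 (x - y).

Definition best_response {R : realType} {n1 n2 : nat} (X2 : set 'rV[R]_n2)
    (J2 : 'rV[R]_n1 -> 'rV[R]_n2 -> R) (x1 : 'rV[R]_n1) : set 'rV[R]_n2 :=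
  argmin X2 (J2 x1).

Definition is_nash {R : realType} {n1 n2 : nat}
    (X1 : set 'rV[R]_n1) (X2 : set 'rV[R]_n2)
    (J1 : 'rV[R]_n1 -> 'rV[R]_n2 -> R) (BR : 'rV[R]_n1 -> set 'rV[R]_n2)
    (x1 : 'rV[R]_n1) (x2 : 'rV[R]_n2) : Prop :=
  [/\ X1 x1, X2 x2, argmin X1 (fun y1 => J1 y1 x2) x1 & BR x1 x2].

(* Num.sqrt is 0 on negative numbers; the radicand can be negative only if
   LG < m. *)
Definition rate {R : realType} (m LG alpha : R) : R :=
  Num.sqrt (1 - 2 * alpha * m + alpha ^+ 2 * LG ^+ 2).

(* Main.v *)
Require Import Defs.
From mathcomp Require Import ring lra.

(* With G x := grad J1 (x, BR2 x), strong convexity of J1(., x2) and the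
   Lipschitz bounds make G strongly monotone with constant m and LG-Lipschitz
   on X1.  Nash equilibria are the pairs (x, BR2 x) with x solving the
   variational inequality <G x, y - x> >= 0 on X1, equivalently the fixed points
   of the projected gradient step.  Since projection is nonexpansive, this step
   contracts by [rate m LG alpha]. *)

Set Implicit Arguments.

Local Open Scope classical_set_scope.
Local Open Scope ring_scope.

(** * Euclidean inner product and norm, and minimisation over compact sets *)

Section InnerProduct.
Context {R : realType} {n : nat}.
Implicit Types (u v w : 'rV[R]_n) (a : R).

Lemma dotvC u v : dotv u v = dotv v u.
Proof. by apply: eq_bigr => i _; rewrite mulrC. Qed.

Lemma dotvDl u v w : dotv (u + v) w = dotv u w + dotv v w.
Proof. by rewrite -big_split; apply: eq_bigr => i _; rewrite mxE mulrDl. Qed.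

Lemma dotvZl a u v : dotv (a *: u) v = a * dotv u v.
Proof. by rewrite [RHS]mulr_sumr; apply: eq_bigr => i _; rewrite mxE mulrA. Qed.

Lemma dotvNl u v : dotv (- u) v = - dotv u v.
Proof. by rewrite -scaleN1r dotvZl mulN1r. Qed.

Lemma dotvDr u v w : dotv u (v + w) = dotv u v + dotv u w.
Proof. by rewrite ![dotv u _]dotvC dotvDl. Qed.

Lemma dotvZr a u v : dotv u (a *: v) = a * dotv u v.
Proof. by rewrite ![dotv u _]dotvC dotvZl. Qed.

Lemma dotvNr u v : dotv u (- v) = - dotv u v.
Proof. by rewrite ![dotv u _]dotvC dotvNl. Qed.

Definition dotvE := (dotvDl, dotvDr, dotvNl, dotvNr, dotvZl, dotvZr).

Lemma dotv_ge0 u : 0 <= dotv u u.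
Proof. by apply: sumr_ge0 => i _; rewrite -expr2 sqr_ge0. Qed.

Lemma norm2_ge0 u : 0 <= norm2 u.
Proof. exact: sqrtr_ge0. Qed.

Lemma sqr_norm2 u : norm2 u ^+ 2 = dotv u u.
Proof. by rewrite sqr_sqrtr // dotv_ge0. Qed.

Lemma dotv_eq0 u : (dotv u u == 0) = (u == 0).
Proof.
rewrite psumr_eq0 => [|i _]; last by rewrite -expr2 sqr_ge0.
apply/allP/eqP => [u0|-> i _]; last by rewrite mxE mulr0 eqxx.
apply/rowP => i; rewrite mxE; apply/eqP.
by have := u0 i (mem_index_enum i); rewrite mulf_eq0 orbb.
Qed.

Lemma norm2_eq0 u : (norm2 u == 0) = (u == 0).
Proof. by rewrite -sqrf_eq0 sqr_norm2 dotv_eq0. Qed.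

Lemma norm2N u : norm2 (- u) = norm2 u.
Proof. by rewrite /norm2 dotvNl dotvNr opprK. Qed.

Lemma norm2_distC u v : norm2 (u - v) = norm2 (v - u).
Proof. by rewrite -norm2N opprB. Qed.

Lemma norm2Z a u : norm2 (a *: u) = `|a| * norm2 u.
Proof.
by rewrite /norm2 dotvZl dotvZr mulrA -expr2 sqrtrM ?sqr_ge0 // sqrtr_sqr.
Qed.

(** Cauchy-Schwarz: with a = |u| and b = |v|, expanding |b u - a v|^2 >= 0 gives 2ab(ab - <u,v>) >=
    0. The case ab = 0 is treated apart so that ab can be cancelled. *)
Lemma dotv_le u v : dotv u v <= norm2 u * norm2 v.
Proof.
have [u0 v0] := (norm2_ge0 u, norm2_ge0 v).
have [/eqP|uv0] := eqVneq (norm2 u * norm2 v) 0.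
  rewrite mulf_eq0 !norm2_eq0 => /orP[]/eqP->;
  by rewrite -(scale0r 0) ?dotvZl ?dotvZr mul0r mulr_ge0 ?norm2_ge0.
have uv_gt0 : 0 < norm2 u * norm2 v by rewrite lt0r uv0 mulr_ge0.
have := dotv_ge0 (norm2 v *: u - norm2 u *: v).
rewrite !dotvE (dotvC v u) -!sqr_norm2.
set a := norm2 u; set b := norm2 v; set c := dotv u v => h.
have {}h : 0 <= (a * b) * (a * b - c) by nra.
by move: h; rewrite pmulr_rge0 // subr_ge0.
Qed.

Lemma norm2D u v : norm2 (u + v) <= norm2 u + norm2 v.
Proof.
rewrite -[leLHS]ger0_norm ?norm2_ge0 //.
rewrite -[leRHS]ger0_norm ?addr_ge0 ?norm2_ge0 //.
rewrite -ler_sqr ?nnegrE ?normr_ge0 // !real_normK ?num_real //.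
rewrite sqrrD !sqr_norm2 !dotvE (dotvC v u).
by have := dotv_le u v; lra.
Qed.

Lemma norm2_lipschitz u v : `|norm2 u - norm2 v| <= norm2 (u - v).
Proof.
have := norm2D (u - v) v; have := norm2D (v - u) u.
by rewrite !subrK (norm2_distC v) ler_norml; lra.
Qed.

Lemma norm2_continuous : continuous (norm2 : 'rV[R]_n -> R).
Proof.
have dot_cont : continuous (fun u : 'rV[R]_n => dotv u u).
  apply: continuous_big => [|i _ u]; first exact: add_continuous.
  by apply: (@cvgM _ _ (nbhs u)); exact: coord_continuous.
by move=> u; apply: continuous_comp; [exact: dot_cont|exact: sqrt_continuous].
Qed.

(** A Lipschitz bound in [norm2] gives continuity for the sup-norm topology because [norm2] is
    itself continuous there, so the extreme value theorem applies. Used for the existence of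
    projections and for the fixed point in [vi_exists]. *)
Lemma compact_lipschitz_min (X : set 'rV[R]_n) (f : 'rV[R]_n -> R) (K : R) :
  X !=set0 -> compact X ->
  (forall x y, X x -> X y -> `|f x - f y| <= K * norm2 (x - y)) ->
  exists2 x, X x & forall y, X y -> f x <= f y.
Proof.
move=> X0 cX lipf.
have cf : {within X, continuous f}.
  apply/subspace_continuousP => x Xx.
  apply/cvgrPdist_le => e e0.
  have sub_cvg : x - y @[y --> x] --> x - x.
    by apply: (@cvgB R 'rV[R]_n _ (nbhs x)); [exact: cvg_cst|exact: cvg_id].
  have dcvg : norm2 (x - y) @[y --> x] --> norm2 (x - x).
    exact: (cvg_comp _ _ sub_cvg (@norm2_continuous (x - x))).
  have : K * norm2 (x - y) @[y --> x] --> K * norm2 (x - x).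
    by apply: (@cvgM _ _ (nbhs x)); [exact: cvg_cst|exact: dcvg].
  rewrite subrr (eqP (_ : norm2 0 == 0)) ?norm2_eq0 // mulr0.
  move=> Kcvg; have dist_small := @cvgr_le _ _ _ (nbhs_filter x) _ _ Kcvg _ e0.
  rewrite near_withinE; apply: filterS dist_small => y + Xy.
  exact: (le_trans (lipf _ _ Xx Xy)).
have [c /set_mem Xc cmin] := EVT_min_rV X0 cX cf.
by exists c => // y Xy; apply: cmin; exact: mem_set.
Qed.

Lemma convex_setP [X : set 'rV[R]_n] [x y : 'rV[R]_n] [t : R] :
  convex_set X -> X x -> X y -> 0 <= t <= 1 -> X (x + t *: (y - x)).
Proof.
move=> cX Xx Xy /andP[t0 t1].
have := cX y x (Itv01 t0 t1) (mem_set Xy) (mem_set Xx) => /set_mem.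
rewrite /conv /=.
by congr (X _); rewrite /unstable.onem scalerBl scale1r scalerBr addrCA.
Qed.

End InnerProduct.

(** * Projection onto a compact convex set *)

Section Projection.
Context {R : realType} {n : nat}.
Implicit Types (X : set 'rV[R]_n) (u v w x y z : 'rV[R]_n).

(** The [get] in [proj] is meaningful only if a nearest point exists; it does, since the distance to
    z is 1-Lipschitz. *)
Lemma proj_argmin X z : X !=set0 -> compact X ->
  argmin X (fun y => norm2 (z - y)) (proj X z).
Proof.
move=> X0 cX.
have [|p Xp pmin] := compact_lipschitz_min (fun y => norm2 (z - y)) 1 X0 cX.
  move=> x y _ _; rewrite mul1r (norm2_distC x y).
  by apply: le_trans (norm2_lipschitz _ _) _; rewrite opprB addrC addrA subrK.
exact: (@getPex _ (argmin X (fun y => norm2 (z - y)))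
  (ex_intro _ p (conj Xp pmin))).
Qed.

Lemma proj_in X z : X !=set0 -> compact X -> X (proj X z).
Proof. by move=> X0 cX; case: (proj_argmin z X0 cX). Qed.

(** Moving from the projection p towards y by a fraction t cannot bring the point closer to z;
    expanding the squares and dividing by t gives 2<z - p, y - p> <= t |y - p|^2. *)
Lemma proj_obtuse [X] z [y] : X !=set0 -> compact X -> convex_set X -> X y ->
  dotv (z - proj X z) (y - proj X z) <= 0.
Proof.
move=> X0 cX vX Xy; have [Xp pmin] := proj_argmin z X0 cX.
set p := proj X z in Xp pmin *.
set d := dotv _ _; set s := dotv (y - p) (y - p).
have key t : 0 < t <= 1 -> 2 * d <= t * s.
  move=> /andP[t0 t1].
  have := pmin _ (convex_setP vX Xp Xy (t := t) _); rewrite ltW //= => /(_ t1).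
  rewrite -ler_sqr ?nnegrE ?norm2_ge0 // !sqr_norm2 opprD addrA.
  rewrite {}/d {}/s; move: (z - p) (y - p) => a b.
  rewrite !dotvE (dotvC b) => h.
  have : 0 <= t * (t * dotv b b - 2 * dotv a b) by lra.
  by rewrite pmulr_rge0 // subr_ge0.
rewrite leNgt; apply/negP => d0.
have := key 1; rewrite ltr01 lexx => /(_ isT) k1.
have s0 : 0 < s by lra.
(* The case t = 1 gives d / s <= 1, so t = d / s is allowed; it yields 2d <= d, against d > 0. *)
have := key (d / s); rewrite divr_gt0 //= ler_pdivrMr // mul1r divfK ?gt_eqF //.
by lra.
Qed.

(** Adding the obtuse-angle inequalities at p and q gives |p - q|^2 <= <z - w, p - q>; combining
    this with |(z - w) - (p - q)|^2 >= 0 finishes. *)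
Lemma proj_nonexpansive X z w : X !=set0 -> compact X -> convex_set X ->
  norm2 (proj X z - proj X w) ^+ 2 <= dotv (z - w) (z - w).
Proof.
move=> X0 cX vX.
have := proj_obtuse z X0 cX vX (proj_in w X0 cX).
have := proj_obtuse w X0 cX vX (proj_in z X0 cX).
rewrite sqr_norm2; set p := proj X z; set q := proj X w => h1 h2.
have split_zw : z - w = (z - p) - (w - q) + (p - q).
  by apply/rowP => i; rewrite !mxE; ring.
have : dotv (p - q) (p - q) <= dotv (z - w) (p - q).
  move: h1 h2; rewrite split_zw -(opprB p q) !(dotvDl (_ - _)) dotvNl dotvNr.
  by move: (dotv (z - p) _) (dotv (w - q) _) (dotv (p - q) _) => a b c; lra.
have := dotv_ge0 ((z - w) - (p - q)).
move: (z - w) (p - q) => a b; rewrite !dotvE (dotvC b a).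
by move: (dotv a a) (dotv a b) (dotv b b) => aa ab bb; lra.
Qed.

End Projection.

(** * First-order conditions for gradients relative to a convex set *)

Section Gradient.
Context {R : realType} {n : nat}.
Implicit Types (X : set 'rV[R]_n) (f : 'rV[R]_n -> R) (x y g : 'rV[R]_n).

(** Reduces the relative gradient to one-sided derivatives along feasible segments, the form in
    which the next lemmas use it. *)
Lemma gradient_within_dir [X f x g y] : convex_set X -> X x -> X y ->
  is_gradient_within X f x g ->
  (f (x + t *: (y - x)) - f x) / t @[t --> 0^'+] --> dotv g (y - x).
Proof.
move=> vX Xx Xy fg; set d := y - x.
have [d0|d0] := eqVneq d 0.
  rewrite d0 -(scale0r 0) dotvZr mul0r.
  under eq_fun do rewrite scale0r scaler0 addr0 subrr mul0r.
  exact: cvg_cst.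
have nd0 : norm2 d != 0 by rewrite norm2_eq0.
(* For 0 < t < 1 the point x + t d differs from x, as d is nonzero, and lies in X by convexity. *)
have seg : (fun t : R => x + t *: d) @ 0^'+ --> within X x^'.
  move=> P; rewrite /within /= /dnbhs /within /= => xP.
  have cseg : (fun t : R => x + t *: d) @ 0^'+ --> x.
    apply: cvg_at_right_filter; rewrite -[X in _ --> X]addr0 -(scale0r d).
    apply: (@cvgD R 'rV[R]_n _ (nbhs 0)); first exact: cvg_cst.
    by apply: (@cvgZ R 'rV[R]_n _ (nbhs 0)); [exact: cvg_id|exact: cvg_cst].
  have {}xP := cseg _ xP; rewrite !near_simpl /= in xP *.
  near=> t; have t0 : 0 < t by [].
  have t1 : t < 1 by near: t; exact: nbhs_right_lt.
  have := near xP t; apply => //.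
  - by rewrite -subr_eq0 addrC addKr scaler_eq0 negb_or gt_eqF.
  - by apply: convex_setP => //; rewrite !ltW.
have quot_cvg : (f (x + t *: d) - f x - dotv g (x + t *: d - x)) /
    norm2 (x + t *: d - x) @[t --> 0^'+] --> (0 : R).
  exact: cvg_comp seg fg.
(* Since |t d| = t |d| for t > 0, multiplying by |d| and adding <g, d> turns the remainder quotient
   into the difference quotient. *)
have : (f (x + t *: d) - f x - dotv g (x + t *: d - x)) /
    norm2 (x + t *: d - x) * norm2 d + dotv g d @[t --> 0^'+] -->
    0 * norm2 d + dotv g d.
  by apply: cvgD; [apply: cvgM => //|]; exact: cvg_cst.
rewrite mul0r add0r; apply: cvg_trans; apply: near_eq_cvg.
near=> t; have t0 : 0 < t by [].
have -> : x + t *: d - x = t *: d by rewrite addrC addKr.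
rewrite norm2Z gtr0_norm // dotvZr.
by field; rewrite nd0 gt_eqF.
Unshelve. all: by end_near. Qed.

(** Strong convexity on the segment from x to y, divided by t, bounds the difference quotient by f y
    - f x - mu/2 (1 - t) |y - x|^2; then t tends to 0 from the right. *)
Lemma strongly_convex_gradient [X f mu x g y] : convex_set X ->
  strongly_convex mu X f -> X x -> X y -> is_gradient_within X f x g ->
  f x + dotv g (y - x) + mu / 2 * norm2 (y - x) ^+ 2 <= f y.
Proof.
move=> vX scf Xx Xy fg; set s := norm2 _ ^+ 2.
have fdir := gradient_within_dir vX Xx Xy fg.
have idcvg : (t : R) @[t --> 0^'+] --> (0 : R).
  by apply: cvg_at_right_filter; exact: cvg_id.
have : f y - f x - mu / 2 * s * (1 - t) @[t --> 0^'+] -->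
    f y - f x - mu / 2 * s * (1 - 0).
  apply: cvgB; first exact: cvg_cst.
  apply: cvgM; first exact: cvg_cst.
  by apply: cvgB => //; exact: cvg_cst.
move=> /(ler_cvg_to fdir) h.
suff : dotv g (y - x) <= f y - f x - mu / 2 * s * (1 - 0) by lra.
apply: h; near=> t; have t0 : 0 < t by [].
have t1 : t < 1 by near: t; exact: nbhs_right_lt.
rewrite ler_pdivrMr //.
have t01 : 0 <= t <= 1 by rewrite !ltW.
have := scf y x t Xy Xx t01; rewrite -/s.
have -> : t *: y + (1 - t) *: x = x + t *: (y - x).
  by rewrite scalerBl scale1r scalerBr addrCA.
by lra.
Unshelve. all: by end_near. Qed.

Lemma argmin_gradient [X f x g y] : convex_set X ->
  argmin X f x -> X y -> is_gradient_within X f x g -> 0 <= dotv g (y - x).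
Proof.
move=> vX [Xx xmin] Xy fg.
apply: (cvgr_to_ge (gradient_within_dir vX Xx Xy fg)).
near=> t; have t0 : 0 < t by [].
have t1 : t < 1 by near: t; exact: nbhs_right_lt.
apply: divr_ge0; last exact: ltW.
by rewrite subr_ge0; apply: xmin; apply: convex_setP => //; rewrite !ltW.
Unshelve. all: by end_near. Qed.

(** Sum of the quadratic lower bounds based at x and at y. *)
Lemma gradient_strongly_monotone [X f mu x y gx gy] : convex_set X ->
  strongly_convex mu X f -> X x -> X y ->
  is_gradient_within X f x gx -> is_gradient_within X f y gy ->
  mu * norm2 (x - y) ^+ 2 <= dotv (gx - gy) (x - y).
Proof.
move=> vX scf Xx Xy fx fy.
have := strongly_convex_gradient vX scf Xx Xy fx.
have := strongly_convex_gradient vX scf Xy Xx fy.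
rewrite (norm2_distC y) dotvDl dotvNl -(opprB x y) dotvNr; lra.
Qed.

End Gradient.

(** * Bounds on the contraction factor *)

Lemma rate_lt1 {R : realType} (m LG alpha : R) :
  0 < alpha -> alpha < 2 * m / LG ^+ 2 -> rate m LG alpha < 1.
Proof.
move=> a0 aub; rewrite -[ltRHS]sqrtr1 ltr_sqrt ?ltr01 //.
(* If LG were 0, the quotient bounding alpha would be 0 by the convention on division, against alpha
   > 0. *)
have LG2 : 0 < LG ^+ 2.
  rewrite lt0r sqr_ge0 andbT; apply/eqP => L0.
  by move: aub; rewrite L0 invr0 mulr0 ltNge ltW.
move: aub; rewrite ltr_pdivlMr // => aub; nra.
Qed.

(** With m = mu - c and LG = L1 + c, the radicand is (1 - alpha m)^2 + alpha^2 (LG - m)(LG + m),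
    where LG - m = L1 - mu + 2c >= 0 and LG + m = L1 + mu > 0. It vanishes exactly in the second
    alternative. *)
Lemma rate_gt0 {R : realType} [mu L1 c : R] (alpha : R) :
  0 <= c -> c < mu -> mu <= L1 ->
  0 < rate (mu - c) (L1 + c) alpha \/ [/\ L1 = mu, c = 0 & alpha * mu = 1].
Proof.
move=> c0 cmu muL1; rewrite /rate sqrtr_gt0.
have [->|a0] := eqVneq alpha 0; first by left; lra.
have a2 : 0 < alpha ^+ 2 by rewrite exprn_even_gt0.
have [gap_gt0|gap_le0] := ltP 0 (L1 - mu + 2 * c).
  left; have : 0 < alpha ^+ 2 * ((L1 - mu + 2 * c) * (L1 + mu)).
    by apply: mulr_gt0 => //; apply: mulr_gt0 => //; lra.
  have := sqr_ge0 (1 - alpha * (mu - c)); lra.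
have cE : c = 0 by lra.
have L1E : L1 = mu by lra.
rewrite cE L1E; have [am1|am1] := eqVneq (alpha * mu) 1; first by right.
left; have : 0 < (1 - alpha * mu) ^+ 2.
  by rewrite exprn_even_gt0 //= subr_eq0 eq_sym.
lra.
Qed.

(** * Variational inequalities and the projected gradient step *)

Definition vi_solution {R : realType} {n : nat} (X : set 'rV[R]_n)
    (G : 'rV[R]_n -> 'rV[R]_n) (x : 'rV[R]_n) : Prop :=
  X x /\ forall y, X y -> 0 <= dotv (G x) (y - x).

Section ProjectedGradientMap.
Context {R : realType} {n : nat} {X : set 'rV[R]_n} {G : 'rV[R]_n -> 'rV[R]_n}.
Context {m : R}.
Hypothesis X0 : X !=set0.
Hypothesis cX : compact X.
Hypothesis vX : convex_set X.
Hypothesis m_gt0 : 0 < m.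
Hypothesis Gmono : forall x y, X x -> X y ->
  m * norm2 (x - y) ^+ 2 <= dotv (G x - G y) (x - y).

(** After nonexpansiveness, expand |(x - y) - alpha (G x - G y)|^2: strong monotonicity controls the
    cross term and the Lipschitz bound the last one. *)
Lemma proj_step_contraction [LG alpha x y] :
  lipschitz_on LG X G -> 0 <= alpha -> X x -> X y ->
  norm2 (proj X (x - alpha *: G x) - proj X (y - alpha *: G y)) <=
    rate m LG alpha * norm2 (x - y).
Proof.
move=> Glip a0 Xx Xy; have s0 := norm2_ge0 (x - y).
have [xy0|xy0] := eqVneq (norm2 (x - y)) 0.
  move/eqP: xy0; rewrite norm2_eq0 subr_eq0 => /eqP->.
  by rewrite !subrr (eqP (_ : norm2 0 == 0)) ?norm2_eq0 // mulr0.
have nexp := proj_nonexpansive (x - alpha *: G x) (y - alpha *: G y) X0 cX vX.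
have split_step : x - alpha *: G x - (y - alpha *: G y) =
    (x - y) - alpha *: (G x - G y).
  by apply/rowP => i; rewrite !mxE; ring.
have lipsq : dotv (G x - G y) (G x - G y) <= LG ^+ 2 * norm2 (x - y) ^+ 2.
  rewrite -sqr_norm2 -exprMn.
  by have := Glip x y Xx Xy; have := norm2_ge0 (G x - G y); nra.
have mono := Gmono Xx Xy.
have sq_le : norm2 (proj X (x - alpha *: G x) - proj X (y - alpha *: G y)) ^+ 2
    <= (1 - 2 * alpha * m + alpha ^+ 2 * LG ^+ 2) * norm2 (x - y) ^+ 2.
  apply: (le_trans nexp); rewrite split_step.
  move: lipsq mono.
  have -> : dotv (x - y - alpha *: (G x - G y)) (x - y - alpha *: (G x - G y)) =
      norm2 (x - y) ^+ 2 - 2 * alpha * dotv (G x - G y) (x - y) +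
      alpha ^+ 2 * dotv (G x - G y) (G x - G y).
    rewrite sqr_norm2; move: (x - y) (G x - G y) => d g.
    by rewrite !dotvE (dotvC d g); ring.
  move: (norm2 (x - y) ^+ 2) (dotv _ (x - y)) (dotv _ (G x - G y)).
  move=> s c g lip mo.
  have h1 : 0 <= alpha * (c - m * s) by rewrite mulr_ge0 // subr_ge0.
  have h2 : 0 <= alpha ^+ 2 * (LG ^+ 2 * s - g).
    by rewrite mulr_ge0 ?sqr_ge0 // subr_ge0.
  lra.
rewrite -(ger0_norm (norm2_ge0 (_ - proj X _))) -sqrtr_sqr.
rewrite -[X in _ <= _ * X](ger0_norm s0) -[X in _ <= _ * X]sqrtr_sqr /rate.
(* The squared norm goes first because [sqrtrM] needs a nonnegative first factor, and the sign of
   the radicand of [rate] is not known here. *)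
by rewrite mulrC -sqrtrM ?sqr_ge0 // mulrC; apply: ler_wsqrtr.
Qed.

(** Let p be the projected point. The obtuse angle at p tested with x, and the inequality at x
    tested with p, give |x - p|^2 <= alpha <G x, x - p> <= 0. *)
Lemma vi_proj_step [alpha x] : 0 <= alpha -> vi_solution X G x ->
  proj X (x - alpha *: G x) = x.
Proof.
move=> a0 [Xx vix].
have := vix _ (proj_in (x - alpha *: G x) X0 cX).
have := proj_obtuse (x - alpha *: G x) X0 cX vX Xx.
set p := proj X _ => obt vip; apply/eqP; rewrite eq_sym -subr_eq0 -dotv_eq0.
rewrite eq_le dotv_ge0 andbT; move: obt vip.
rewrite addrAC dotvDl dotvNl dotvZl -(opprB x p) dotvNr.
move: (dotv (x - p) _) (dotv (G x) _) => s c.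
nra.
Qed.

Lemma proj_step_vi [alpha x] : 0 < alpha -> X x ->
  proj X (x - alpha *: G x) = x -> vi_solution X G x.
Proof.
move=> a0 Xx fix_x; split => // y Xy.
have := proj_obtuse (x - alpha *: G x) X0 cX vX Xy; rewrite fix_x.
by rewrite addrAC subrr add0r dotvNl dotvZl oppr_le0 pmulr_rge0.
Qed.

Lemma vi_unique [x y] : vi_solution X G x -> vi_solution X G y -> x = y.
Proof.
move=> [Xx vix] [Xy viy]; apply/eqP; rewrite -subr_eq0 -norm2_eq0 -sqrf_eq0.
rewrite eq_le sqr_ge0 andbT -(pmulr_rle0 _ m_gt0).
apply: (le_trans (Gmono Xx Xy)); rewrite dotvDl dotvNl.
have := vix _ Xy; have := viy _ Xx; rewrite -(opprB x y) dotvNr.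
by move: (dotv (G x) _) (dotv (G y) _) => a b; lra.
Qed.

(* On a compact set a minimiser of the displacement [x |-> |x - T x|] of a
   contraction [T] is a fixed point of [T]. *)
Lemma vi_exists LG : lipschitz_on LG X G -> exists x, vi_solution X G x.
Proof.
(* [LG] may be zero or negative, so it is enlarged to a positive K; the step m / K^2 is then the
   midpoint of the admissible interval. *)
move=> Glip; pose K : R := `|LG| + 1; have K_gt0 : 0 < K by rewrite ltr_wpDl.
have GlipK : lipschitz_on K X G.
  move=> x y Xx Xy; apply: (le_trans (Glip x y Xx Xy)).
  apply: ler_wpM2r; first exact: norm2_ge0.
  by rewrite /K; have := ler_norm LG; lra.
pose alpha := m / K ^+ 2; pose T x := proj X (x - alpha *: G x).
have K2_gt0 : 0 < K ^+ 2 by rewrite exprn_gt0.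
have a_gt0 : 0 < alpha by rewrite divr_gt0.
pose rho := rate m K alpha.
have rho_lt1 : rho < 1.
  apply: rate_lt1 => //.
  by rewrite ltr_pM2r ?invr_gt0 // mulr_natl mulr2n ltrDl.
have TX x : X (T x) by exact: proj_in.
have Tlip x y : X x -> X y -> norm2 (T x - T y) <= rho * norm2 (x - y).
  by apply: proj_step_contraction => //; exact: ltW.
have [x y Xx Xy|x Xx xmin] :=
    compact_lipschitz_min (fun x => norm2 (x - T x)) (1 + rho) X0 cX.
  apply: (le_trans (norm2_lipschitz _ _)); rewrite mulrDl mul1r.
  have -> : x - T x - (y - T y) = (x - y) + (- (T x - T y)).
    by apply/rowP => i; rewrite !mxE; ring.
  by apply: (le_trans (norm2D _ _)); rewrite norm2N lerD2l Tlip.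
exists x; apply: (proj_step_vi a_gt0 Xx); apply/eqP.
rewrite eq_sym -subr_eq0 -norm2_eq0 eq_le norm2_ge0 andbT leNgt.
apply/negP => disp_gt0; have := le_trans (xmin _ (TX x)) (Tlip _ _ Xx (TX x)).
by rewrite leNgt gtr_pMl // rho_lt1.
Qed.

End ProjectedGradientMap.

(** * Linear convergence to the Nash equilibrium *)

Theorem theorem3 (R : realType) (n1 n2 : nat)
    (X1 : set 'rV[R]_n1) (X2 : set 'rV[R]_n2)
    (X1_nonempty : X1 !=set0) (X1_convex : convex_set X1)
    (X1_compact : compact X1)
    (X2_nonempty : X2 !=set0) (X2_convex : convex_set X2)
    (X2_compact : compact X2)
    (J1 J2 : 'rV[R]_n1 -> 'rV[R]_n2 -> R)
    (J1_continuous : {within X1 `*` X2,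
       continuous (fun p : 'rV[R]_n1 * 'rV[R]_n2 => J1 p.1 p.2)})
    (gradJ1 : 'rV[R]_n1 -> 'rV[R]_n2 -> 'rV[R]_n1)
    (BR2 : 'rV[R]_n1 -> 'rV[R]_n2)
    (mu L1 L12 L2 : R)
    (mu_gt0 : 0 < mu)
    (J1_differentiable : forall x1 x2, X1 x1 -> X2 x2 ->
       is_gradient_within X1 (fun y1 => J1 y1 x2) x1 (gradJ1 x1 x2))
    (J1_strongly_convex : forall x2, X2 x2 ->
       strongly_convex mu X1 (fun x1 => J1 x1 x2))
    (L12_ge0 : 0 <= L12)
    (gradJ1_lipschitz2 : forall x1, X1 x1 -> lipschitz_on L12 X2 (gradJ1 x1))
    (BR2_single_valued : forall x1, X1 x1 ->
       best_response X2 J2 x1 = [set BR2 x1])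
    (L2_ge0 : 0 <= L2)
    (BR2_lipschitz : lipschitz_on L2 X1 BR2)
    (J1_smooth : forall x2, X2 x2 ->
       lipschitz_on L1 X1 (fun x1 => gradJ1 x1 x2))
    (mu_gt : L12 * L2 < mu) :
  let m := mu - L12 * L2 in
  let LG := L1 + L12 * L2 in
  exists (x1s : 'rV[R]_n1) (x2s : 'rV[R]_n2),
    [/\ is_nash X1 X2 J1 (best_response X2 J2) x1s x2s,
        (forall y1 y2, is_nash X1 X2 J1 (best_response X2 J2) y1 y2 ->
           y1 = x1s /\ y2 = x2s) &
        forall alpha : R, 0 < alpha -> alpha < 2 * m / LG ^+ 2 ->
          let rho := rate m LG alpha in
          [/\ 0 <= rho < 1,
              [\/ 0 < rho,
                  [/\ L1 = mu, L12 * L2 = 0 & alpha * mu = 1] |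
                  L1 < mu /\ exists a, X1 = [set a]] &
              forall (x1 : nat -> 'rV[R]_n1) (x2 : nat -> 'rV[R]_n2),
                X1 (x1 0%N) ->
                (forall k, x2 k = BR2 (x1 k)) ->
                (forall k, x1 k.+1 =
                   proj X1 (x1 k - alpha *: gradJ1 (x1 k) (x2 k))) ->
                forall k : nat,
                  norm2 (x1 k - x1s) <= rho ^+ k * norm2 (x1 0%N - x1s) /\
                  norm2 (x2 k - x2s) <= L2 * rho ^+ k * norm2 (x1 0%N - x1s)]].
Proof.
move=> m LG; pose G x := gradJ1 x (BR2 x).
have m_gt0 : 0 < m by rewrite subr_gt0.
have BRP x1 x2 : X1 x1 -> best_response X2 J2 x1 x2 <-> x2 = BR2 x1.
  by move=> /BR2_single_valued ->.
have BRX x1 : X1 x1 -> X2 (BR2 x1).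
  by move=> Xx; have [] : best_response X2 J2 x1 (BR2 x1) by apply/BRP.
have gradmono x y x2 : X1 x -> X1 y -> X2 x2 ->
    mu * norm2 (x - y) ^+ 2 <= dotv (gradJ1 x x2 - gradJ1 y x2) (x - y).
  move=> Xx Xy Xx2.
  by apply: (gradient_strongly_monotone X1_convex (J1_strongly_convex _ Xx2));
    try exact: J1_differentiable.
(* First the strategy changes with the response frozen at [BR2 x], then the response changes. The
   first part carries the constants mu and L1, the second L12 * L2. *)
have Gsplit x y : G x - G y =
    (gradJ1 x (BR2 x) - gradJ1 y (BR2 x)) + (gradJ1 y (BR2 x) - G y).
  by rewrite addrA subrK.
have Gcross x y : X1 x -> X1 y ->
    norm2 (gradJ1 y (BR2 x) - G y) <= L12 * L2 * norm2 (x - y).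
  move=> Xx Xy.
  apply: le_trans (gradJ1_lipschitz2 _ Xy _ _ (BRX _ Xx) (BRX _ Xy)) _.
  by rewrite -mulrA ler_wpM2l // BR2_lipschitz.
have Gmono x y : X1 x -> X1 y ->
    m * norm2 (x - y) ^+ 2 <= dotv (G x - G y) (x - y).
  move=> Xx Xy; rewrite Gsplit dotvDl.
  have := gradmono _ _ _ Xx Xy (BRX _ Xx).
  (* The sign makes Cauchy-Schwarz a lower bound on the cross term. *)
  have := dotv_le (- (gradJ1 y (BR2 x) - G y)) (x - y).
  rewrite norm2N dotvNl.
  have := ler_wpM2r (norm2_ge0 (x - y)) (Gcross _ _ Xx Xy).
  rewrite -(mulrA (L12 * L2)) -expr2 /m mulrBl.
  move: (norm2 _ * _) (dotv _ _) (dotv _ _) (norm2 _ ^+ 2) => a b c d; lra.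
have Glip : lipschitz_on LG X1 G.
  move=> x y Xx Xy; rewrite Gsplit mulrDl.
  apply: (le_trans (norm2D _ _)); apply: lerD; last exact: Gcross.
  exact: (J1_smooth _ (BRX _ Xx) _ _ Xx Xy).
(* Left to right is first-order optimality; conversely, the strong convexity lower bound makes the
   variational inequality sufficient for a minimum. *)
have nash_vi x1 x2 : is_nash X1 X2 J1 (best_response X2 J2) x1 x2 <->
    vi_solution X1 G x1 /\ x2 = BR2 x1.
  split=> [[Xx1 Xx2 xmin /(BRP _ _ Xx1) x2E]|[[Xx1 vix] ->]].
    split=> //; split=> // y Xy; rewrite /G -x2E.
    exact: (argmin_gradient X1_convex xmin Xy (J1_differentiable _ _ Xx1 Xx2)).
  have Xx2 := BRX _ Xx1; split => //; last by apply/BRP.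
  split=> // y Xy.
  have := strongly_convex_gradient X1_convex (J1_strongly_convex _ Xx2) Xx1 Xy
    (J1_differentiable _ _ Xx1 Xx2).
  have := vix _ Xy; have : 0 <= mu / 2 * norm2 (y - x1) ^+ 2.
    by rewrite mulr_ge0 ?sqr_ge0 // divr_ge0 // ltW.
  by rewrite /G; move: (dotv _ _) (mu / 2 * _) => a b; lra.
have [x1s vis] := vi_exists X1_nonempty X1_compact X1_convex m_gt0 Gmono Glip.
have Xs : X1 x1s by case: vis.
exists x1s, (BR2 x1s); split; first by apply/nash_vi.
  move=> y1 y2 /nash_vi[viy ->].
  by rewrite (vi_unique m_gt0 Gmono viy vis).
move=> alpha a_gt0 alpha_lt rho.
have rho_ge0 : 0 <= rho by exact: sqrtr_ge0.
split; first by rewrite rho_ge0 rate_lt1.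
  have [muL1|L1mu] := leP mu L1.
    have c_ge0 : 0 <= L12 * L2 by rewrite mulr_ge0.
    have [rho_gt0|critical] := rate_gt0 alpha c_ge0 mu_gt muL1.
      exact: Or31.
    exact: Or32.
  (* When L1 < mu, strong monotonicity and smoothness give mu |y - x1s|^2 <= L1 |y - x1s|^2, so
     every y in [X1] equals x1s. *)
  apply: Or33; split => //; exists x1s; apply/seteqP; split => [y Xy|y ->//].
  have := le_trans (gradmono _ _ _ Xy Xs (BRX _ Xs)) (dotv_le _ _).
  have := ler_wpM2r (norm2_ge0 (y - x1s)) (J1_smooth _ (BRX _ Xs) _ _ Xy Xs).
  move=> h1 h2; have := le_trans h2 h1; rewrite -mulrA -expr2.
  rewrite -subr_le0 -mulrBl pmulr_rle0 ?subr_gt0 // => le0.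
  apply/eqP; rewrite -subr_eq0 -norm2_eq0 -sqrf_eq0.
  by rewrite eq_le sqr_ge0 le0.
move=> x1 x2 X10 x2E x1E.
have X1k k : X1 (x1 k) by case: k => // k; rewrite x1E; exact: proj_in.
have rate1 k : norm2 (x1 k - x1s) <= rho ^+ k * norm2 (x1 0%N - x1s).
  elim: k => [|k IHk]; first by rewrite expr0 mul1r.
  rewrite exprS -mulrA; apply: le_trans (ler_wpM2l rho_ge0 IHk).
  rewrite x1E x2E -/(G _).
  (* The equilibrium is rewritten as its own projected step, so that both sides of the difference
     are images of the contraction. *)
  rewrite -{1}(vi_proj_step X1_nonempty X1_compact X1_convex (ltW a_gt0) vis).
  by apply: proj_step_contraction => //; exact: ltW.
move=> k; split => //; rewrite x2E -mulrA.
exact: le_trans (BR2_lipschitz _ _ (X1k k) Xs) (ler_wpM2l L2_ge0 (rate1 k)).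
Qed.
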